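(* Let $S$ be a commutative unital ring, $\sigma\in\mathrm{Aut}(S)$ of finite order $m$, $S_0=\{s\in S:\sigma(s)=s\}$, and $n\ge 2$. Suppose $a,b\in S_0^\times$ and $m\mid n$. Let $\tau\in\mathrm{Aut}(S)$ commute with $\sigma$ and let $\alpha\in S^\times$. Then the following are equivalent for any integer $1\le k<n$: (i) $\mathbb{S}_{t^n-a}$ and $\mathbb{S}_{t^n-b}$ are isometric via $G_{\tau,\alpha,k}$, i.e. $G_{\tau,\alpha,k}:\mathbb{S}_{t^n-a}\to\mathbb{S}_{t^n-b}$ is a ring isomorphism; (ii) $\mathbb{S}_{t^n-a}$ and $\mathbb{S}_{t^n-b^k}$ are equivalent via $G_{\tau,\alpha}$, i.e. $G_{\tau,\alpha}:\mathbb{S}_{t^n-a}\to\mathbb{S}_{t^n-b^k}$ is a ring isomorphism, and $k$ satisfies $k\equiv1\pmod m$ and $\gcd(k,n)=1$; (iii) $\tau(a)=N_n^\sigma(\alpha)\,b^k$, where $k\equiv 1\pmod m$ and $\gcd(k,n)=1$.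
   Context: Rings $S$ are commutative, associative, with $1\ne 0$. $S[t;\sigma]$ is the skew polynomial ring with $tc=\sigma(c)t$ for $c\in S$. For a monic $f\in S[t;\sigma]$ of degree $n$, every $g\in S[t;\sigma]$ can be written uniquely as $g=qf+r$ with $\deg r<n$; write $r=g \bmod_r f$. The Petit ring $\mathbb{S}_f$ is the additive group of skew polynomials of degree $<n$ with multiplication $g\circ h=gh \bmod_r f$ (under the hypotheses here, $\mathbb{S}_{t^n-a}$ is the associative quotient ring $S[t;\sigma]/S[t;\sigma](t^n-a)$). $N_n^\sigma(\alpha)=\prod_{j=0}^{n-1}\sigma^j(\alpha)$. $G_{\tau,\alpha,k}$ denotes the ring homomorphism (if it exists) with $G|_S=\tau$ and $G(t)=\alpha t^k$, i.e. $G(\sum_{i=0}^{n-1}a_it^i)=\sum_{i=0}^{n-1}\tau(a_i)(\alpha t^k)^i$; $G_{\tau,\alpha}=G_{\tau,\alpha,1}$. *)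

(* Defs.v *)
From HB Require Import structures.
From mathcomp Require Import all_boot all_order all_algebra.

Set Implicit Arguments.
Unset Strict Implicit.
Unset Printing Implicit Defensive.

Import GRing.Theory.
Local Open Scope ring_scope.

(* The skew polynomial ring S[t; sigma], with t * c = sigma(c) * t: it has the
   underlying additive group of {poly S} (coefficients on the left, t = 'X) and
   the product (a t^i) (b t^j) = a sigma^i(b) t^(i+j). *)
Definition skewpoly (S : comNzRingType) (sigma : {rmorphism S -> S}) : Type :=
  {poly S}.

Section SkewRing.
Variables (S : comNzRingType) (sigma : {rmorphism S -> S}).
Local Notation sig i := (iter i sigma).
Implicit Types p q r : {poly S}.

HB.instance Definition _ := GRing.Zmodule.on (skewpoly sigma).

Definition skew_mul p q : {poly S} :=
  \poly_(i < (size p + size q).-1)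
     (\sum_(j < i.+1) p`_j * sig j q`_(i - j)).

Lemma iter_sig0 i : sig i 0 = 0 :> S.
Proof. by elim: i => //= i ->; rewrite rmorph0. Qed.

Lemma iter_sig1 i : sig i 1 = 1 :> S.
Proof. by elim: i => //= i ->; rewrite rmorph1. Qed.

Lemma iter_sigD i : {morph sig i : x y / x + y}.
Proof. by move=> x y; elim: i => //= i ->; rewrite rmorphD. Qed.

Lemma iter_sigM i : {morph sig i : x y / x * y}.
Proof. by move=> x y; elim: i => //= i ->; rewrite rmorphM. Qed.

Lemma iter_sig_sum i I (r : seq I) (P : pred I) (F : I -> S) :
  sig i (\sum_(j <- r | P j) F j) = \sum_(j <- r | P j) sig i (F j).
Proof. exact: (big_morph _ (@iter_sigD i) (iter_sig0 i)). Qed.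

Lemma coef_skew_mul p q i :
  (skew_mul p q)`_i = \sum_(j < i.+1) p`_j * sig j q`_(i - j).
Proof.
rewrite coef_poly ltn_predRL; case: leqP => // le_pq_i1.
rewrite big1 // => j _; have [lq_p_j|lt_j_p] := leqP (size p) j.
  by rewrite nth_default ?mul0r.
rewrite [q`__]nth_default ?iter_sig0 ?mulr0 // leq_subRL -ltnS //.
by rewrite (leq_trans _ le_pq_i1) // ltn_add2r.
Qed.

Lemma coef_skew_mul_rev p q i :
  (skew_mul p q)`_i = \sum_(j < i.+1) p`_(i - j) * sig (i - j) q`_j.
Proof.
rewrite coef_skew_mul (reindex_inj rev_ord_inj) /=.
by apply: eq_bigr => j _; rewrite (sub_ordK j).
Qed.

Lemma skew_mulA : associative skew_mul.
Proof.
move=> p q r; apply/polyP=> i; rewrite coef_skew_mul coef_skew_mul_rev.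
pose coef3 j k :=
  p`_j * (sig j q`_(i - j - k)%N * sig (i - k) r`_k).
transitivity (\sum_(j < i.+1) \sum_(k < i.+1 | (k <= i - j)%N) coef3 j k).
  apply: eq_bigr => /= j _.
  rewrite coef_skew_mul_rev iter_sig_sum big_distrr /=.
  rewrite (big_ord_narrow_leq (leq_subr _ _)).
  apply: eq_bigr => k _; rewrite /coef3 iter_sigM -iterD.
  have le_kij : (k <= i - j)%N by rewrite -ltnS.
  by rewrite addnBA // subnKC // -ltnS.
rewrite (exchange_big_dep predT) //=; apply: eq_bigr => k _.
transitivity (\sum_(j < i.+1 | (j <= i - k)%N) coef3 j k).
  apply: eq_bigl => j; rewrite -ltnS -(ltnS j) -!subSn ?leq_ord //.
  by rewrite -subn_gt0 -(subn_gt0 j) -!subnDA addnC.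
rewrite (big_ord_narrow_leq (leq_subr _ _)) coef_skew_mul big_distrl /=.
by apply: eq_bigr => j _; rewrite /coef3 -!subnDA addnC mulrA.
Qed.

Lemma skew_mul1p : left_id (1%:P : {poly S}) skew_mul.
Proof.
move=> p; apply/polyP => i; rewrite coef_skew_mul big_ord_recl subn0.
by rewrite big1 => [|j _]; rewrite coefC /= ?mul1r ?addr0 ?mul0r.
Qed.

Lemma skew_mulp1 : right_id (1%:P : {poly S}) skew_mul.
Proof.
move=> p; apply/polyP => i; rewrite coef_skew_mul_rev big_ord_recl subn0.
by rewrite big1 => [|j _]; rewrite coefC /= ?iter_sig1 ?iter_sig0 ?mulr1 ?mulr0 ?addr0.
Qed.

Lemma skew_mulDl : left_distributive skew_mul +%R.
Proof.
move=> p q r; apply/polyP=> i; rewrite coefD !coef_skew_mul -big_split.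
by apply: eq_bigr => j _; rewrite coefD mulrDl.
Qed.

Lemma skew_mulDr : right_distributive skew_mul +%R.
Proof.
move=> p q r; apply/polyP=> i; rewrite coefD !coef_skew_mul -big_split.
by apply: eq_bigr => j _; rewrite coefD iter_sigD mulrDr.
Qed.

Lemma skew_1_neq0 : (1%:P : skewpoly sigma) != 0.
Proof. by rewrite polyC_eq0 oner_neq0. Qed.

HB.instance Definition _ := GRing.Zmodule_isNzRing.Build (skewpoly sigma)
  skew_mulA skew_mul1p skew_mulp1 skew_mulDl skew_mulDr skew_1_neq0.

Definition skewval (p : skewpoly sigma) : {poly S} := p.
Arguments skewval p%_R.

Definition skewC (c : S) : skewpoly sigma := c%:P.
Definition skewT : skewpoly sigma := 'X.
Definition skewM (c : S) (d : nat) : skewpoly sigma := c *: 'X^d.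

Lemma coef_skewM_mul c d (q : skewpoly sigma) i :
  (skewval (skewM c d * q))`_i =
    if (i < d)%N then 0 else c * sig d (skewval q)`_(i - d).
Proof.
rewrite [LHS]coef_skew_mul; have [lt_id|le_di] := ltnP i d.
  rewrite big1 // => j _; rewrite coefZ coefXn.
  by rewrite ltn_eqF ?mulr0 ?mul0r // (leq_ltn_trans _ lt_id) // -ltnS.
have lt_di1 : (d < i.+1)%N by [].
rewrite (bigD1 (Ordinal lt_di1)) //= coefZ coefXn eqxx mulr1 big1 ?addr0 //.
move=> j; rewrite -val_eqE /= => /negPf ne_jd.
by rewrite coefZ coefXn ne_jd mulr0 mul0r.
Qed.

Lemma skewTC c : skewT * skewC c = skewC (sigma c) * skewT.
Proof.
have -> : skewT = skewM 1 1 by rewrite /skewM scale1r.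
have -> : skewC (sigma c) = skewM (sigma c) 0 by rewrite /skewM expr0 alg_polyC.
apply/polyP => i; rewrite !coef_skewM_mul ltn0 subn0 /= coefC.
rewrite /skewM scale1r coefX.
by case: i => [|[|i]] //=; rewrite ?mulr0 ?mulr1 ?mul1r ?rmorph0.
Qed.

Lemma skewTn n : skewT ^+ n = skewM 1 n.
Proof.
elim: n => [|n IHn]; first by rewrite /skewM !expr0 scale1r.
rewrite exprS IHn; have -> : skewT = skewM 1 1 by rewrite /skewM scale1r.
apply/polyP => i; rewrite coef_skewM_mul /skewM !scale1r !coefXn mul1r /=.
by case: i => [|i] //; rewrite subn1 /= eqSS; case: eqP; rewrite ?rmorph1 ?rmorph0.
Qed.

Lemma skewME c d : skewM c d = skewC c * skewT ^+ d.
Proof.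
have -> : skewC c = skewM c 0 by rewrite /skewM expr0 alg_polyC.
rewrite skewTn; apply/polyP => i; rewrite coef_skewM_mul ltn0 subn0 /=.
by rewrite /skewM scale1r coefZ.
Qed.

(* Remainder of the right division of p by a monic f, p = q * f + r with
   deg r < deg f: the leading term c t^e of p is cancelled by subtracting
   c t^(e - deg f) * f.  The first argument bounds the number of steps. *)
Fixpoint skew_mod_rec (n : nat) (f p : skewpoly sigma) : skewpoly sigma :=
  if n is n'.+1 then
    if (size (skewval p) < size (skewval f))%N then p
    else skew_mod_rec n' f
      (p - skewM (lead_coef (skewval p)) (size (skewval p) - size (skewval f)) * f)
  else p.

Definition skew_mod (f p : skewpoly sigma) : skewpoly sigma :=
  skew_mod_rec (size (skewval p)) f p.

Lemma skew_mod_recP n (f p : skewpoly sigma) :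
    skewval f \is monic -> (size (skewval p) <= n)%N ->
  (size (skewval (skew_mod_rec n f p)) < size (skewval f))%N
  /\ exists q : skewpoly sigma, p = q * f + skew_mod_rec n f p.
Proof.
move=> f_monic.
have f_gt0 : (0 < size (skewval f))%N by rewrite size_poly_gt0 monic_neq0.
elim: n p => [|n IHn] p /= le_pn.
  split; first exact: leq_ltn_trans f_gt0.
  by exists 0; rewrite mul0r add0r.
have [lt_pf|le_fp] := ltnP (size (skewval p)) (size (skewval f)).
  by split=> //; exists 0; rewrite mul0r add0r.
set d := (size (skewval p) - size (skewval f))%N.
set s := skewM _ d; have [|lt_r [q Dq]] := IHn (p - s * f).
  apply/leq_sizeP => j le_nj; rewrite coefB coef_skewM_mul.
  have [lt_jp|le_pj] := ltnP j (size (skewval p)).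
    have Dj : j = (size (skewval p)).-1.
      have /eqP-> // : size (skewval p) == j.+1.
      by rewrite eqn_leq lt_jp (leq_trans le_pn).
    have Djd : (j - d = (size (skewval f)).-1)%N.
      by rewrite Dj /d -subn1 -subnDA addnC subnDA subKn // subn1.
    have -> : (j < d)%N = false.
      rewrite ltnNge Dj; apply/negbF; rewrite /d -subn1 leq_sub //.
    rewrite Djd -[X in iter d sigma X]/(lead_coef f) (monicP f_monic).
    by rewrite iter_sig1 mulr1 Dj subrr.
  rewrite nth_default // sub0r; case: ltnP => [|le_dj]; rewrite ?oppr0 //.
  rewrite [X in iter d sigma X]nth_default ?iter_sig0 ?mulr0 ?oppr0 //.
  by rewrite leq_subRL // /d subnK.
split=> //; exists (s + q).
by rewrite mulrDl -addrA -Dq addrC subrK.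
Qed.

Lemma skew_modP (f p : skewpoly sigma) : skewval f \is monic ->
  (size (skewval (skew_mod f p)) < size (skewval f))%N
  /\ exists q : skewpoly sigma, p = q * f + skew_mod f p.
Proof. by move=> f_monic; apply: skew_mod_recP. Qed.

Lemma lt_size_skew_mulr (f q : skewpoly sigma) : skewval f \is monic ->
  (size (skewval (q * f)) < size (skewval f))%N -> q = 0.
Proof.
move=> f_monic lt_qf; apply/eqP; apply: contraLR lt_qf => q_neq0.
have f_gt0 : (0 < size (skewval f))%N by rewrite size_poly_gt0 monic_neq0.
have q_gt0 : (0 < size (skewval q))%N by rewrite size_poly_gt0.
set m := (size (skewval q)).-1; set d := (size (skewval f)).-1.
suff: (skewval (q * f))`_(m + d) != 0.
  rewrite -leqNgt; apply: contraR; rewrite -ltnNge => lt_qf.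
  rewrite nth_default // (leq_trans _ (leq_addl _ _)) //.
  by rewrite -ltnS /d prednK.
have lt_m : (m < (m + d).+1)%N by rewrite ltnS leq_addr.
rewrite [X in X != 0]coef_skew_mul (bigD1 (Ordinal lt_m)) //= addKn.
rewrite -[f`_d]/(lead_coef f) (monicP f_monic) iter_sig1 mulr1 big1 ?addr0.
  by rewrite -[X in X != 0]/(lead_coef q) lead_coef_eq0.
move=> j; rewrite -val_eqE /= neq_ltn => /orP[lt_jm|lt_mj].
  rewrite [f`__]nth_default ?iter_sig0 ?mulr0 //.
  by rewrite -(prednK f_gt0) -/d ltn_subRL ltn_add2r.
by rewrite nth_default ?mul0r // -(prednK q_gt0).
Qed.

Lemma skew_mod_unique (f p q r : skewpoly sigma) : skewval f \is monic ->
  (size (skewval r) < size (skewval f))%N -> p = q * f + r ->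
  skew_mod f p = r.
Proof.
move=> f_monic lt_rf Dp; have [lt_mf [q' Dp']] := skew_modP p f_monic.
have Eqf : (q - q') * f = skew_mod f p - r.
  rewrite mulrBl; apply/eqP; rewrite subr_eq addrAC -subr_eq opprK.
  by rewrite -Dp addrC -Dp'.
have q0 : q - q' = 0.
  apply: (lt_size_skew_mulr f_monic); rewrite Eqf.
  by apply: leq_ltn_trans (size_polyD _ _) _; rewrite size_polyN gtn_max lt_mf.
by apply/eqP; rewrite -subr_eq0 -Eqf q0 mul0r.
Qed.

End SkewRing.

(* The Petit ring S_f of a monic skew polynomial f.  It is nonassociative for a
   general f, so that its product is kept as a plain function. *)
Definition petit (S : comNzRingType) (sigma : {rmorphism S -> S})
  (f : skewpoly sigma) : Type := {poly_((size (skewval f)).-1) S}.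

Section Petit.
Variables (S : comNzRingType) (sigma : {rmorphism S -> S}).
Implicit Types f : skewpoly sigma.

HB.instance Definition _ f := GRing.Zmodule.on (petit f).

(* npolyp does not truncate anything here when f is monic, see petit_redK. *)
Definition petit_red f (p : skewpoly sigma) : petit f :=
  npolyp _ (skewval (skew_mod f p)).

Definition petit_val f (g : petit f) : skewpoly sigma := polyn g.

Lemma petit_redK f p : skewval f \is monic ->
  petit_val (petit_red f p) = skew_mod f p.
Proof.
move=> f_monic; have [lt_rf _] := skew_modP p f_monic.
apply/polyP => i; rewrite [LHS]coef_npolyp; case: ltnP => // le_fi.
by rewrite nth_default // (leq_trans _ le_fi) // -ltnS (ltn_predK lt_rf).
Qed.

Definition petit_mul f (g h : petit f) : petit f :=
  petit_red f (petit_val g * petit_val h).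

Definition petitC f (c : S) : petit f := petit_red f (skewC sigma c).
Definition petitT f : petit f := petit_red f (skewT sigma).

(* Right-nested powers x o (x o (... o (x o 1))). *)
Definition petit_exp f (x : petit f) (i : nat) : petit f :=
  iter i (petit_mul x) (petitC f 1).

Definition petit_ring_iso f f' (G : petit f -> petit f') : Prop :=
  [/\ bijective G,
      {morph G : x y / x + y},
      {morph G : x y / petit_mul x y} &
      G (petitC f 1) = petitC f' 1].

(* G_{tau,alpha,k}: the sum of the a_i t^i, i < deg f, goes to the sum of the
   tau(a_i) (alpha t^k)^i, computed in S_f'. *)
Definition petit_G f f' (tau : S -> S) (alpha : S) (k : nat) (g : petit f) :
    petit f' :=
  \sum_(i < (size (skewval f)).-1)
    petit_mul (petitC f' (tau (skewval (petit_val g))`_i))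
      (petit_exp (petit_mul (petitC f' alpha) (petit_exp (petitT f') k)) i).

End Petit.

Definition skew_binomial (S : comNzRingType) (sigma : {rmorphism S -> S})
  (n : nat) (a : S) : skewpoly sigma := skewT sigma ^+ n - skewC sigma a.

Lemma skew_binomialE (S : comNzRingType) (sigma : {rmorphism S -> S})
  (n : nat) (a : S) : skew_binomial sigma n a = 'X^n - a%:P :> {poly S}.
Proof. by rewrite /skew_binomial skewTn /skewM scale1r. Qed.

Definition fixed_ring (S : comNzRingType) (sigma : S -> S) : {pred S} :=
  [pred s | sigma s == s].

(* u is a unit of the subring D of S.  A comNzRingType comes with no (boolean)
   unit predicate. *)
Definition unit_in (S : comNzRingType) (D : {pred S}) (u : S) : Prop :=
  u \in D /\ exists2 v, v \in D & u * v = 1.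

Definition has_order (T : Type) (sigma : T -> T) (m : nat) : Prop :=
  [/\ (0 < m)%N, iter m sigma =1 id &
      forall j, (0 < j < m)%N -> ~ (iter j sigma =1 id)].

Definition skew_norm (S : comNzRingType) (sigma : S -> S) (n : nat) (alpha : S)
  : S := \prod_(j < n) iter j sigma alpha.

Definition isometric_via (S : comNzRingType) (sigma : {rmorphism S -> S})
    (n : nat) (a b : S) (tau : S -> S) (alpha : S) (k : nat) : Prop :=
  petit_ring_iso (@petit_G S sigma (skew_binomial sigma n a)
                    (skew_binomial sigma n b) tau alpha k).

Definition equivalent_via (S : comNzRingType) (sigma : {rmorphism S -> S})
    (n : nat) (a b : S) (tau : S -> S) (alpha : S) : Prop :=
  isometric_via sigma n a b tau alpha 1.

(* Main.v *)
(* Since sigma^n = 1 and b is fixed, t^n - b is central, so S_(t^n - b) is the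
   quotient ring of S[t; sigma] by t^n = b.  If G is an isomorphism, comparing
   G(t c) with G(sigma(c) t) gives sigma^k = sigma; then G(t)^n = G(a) reads
   N(alpha) b^k = tau(a); and if d = gcd(k, n) > 1, G would send t^(n/d) to a
   constant, contradicting injectivity.  Conversely, under these conditions the
   map t |-> alpha t^k extends tau to an endomorphism of S[t; sigma] sending
   t^n - a to a multiple of t^n - b, hence induces G, and G is bijective since it
   carries t^i to a unit multiple of t^(k i mod n), where i |-> k i mod n is a
   permutation.  Both (i) and the case of the pair (b^k, 1) in (ii) are instances
   of this criterion. *)
Require Import Defs.
From mathcomp Require Import all_boot all_order all_algebra.
From mathcomp Require Import ring zify.

Set Implicit Arguments.
Unset Strict Implicit.
Unset Printing Implicit Defensive.

Import GRing.Theory.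
Local Open Scope ring_scope.

(** * Arithmetic of skew monomials *)

Section SkewMonomials.
Variables (S : comNzRingType) (sigma : {rmorphism S -> S}).
Local Notation sig i := (iter i sigma).
Local Notation M := (skewM sigma).
Implicit Types (p q r : skewpoly sigma) (c e : S) (i j d : nat).

Lemma coef_skewM c d i : (skewval (M c d))`_i = if i == d then c else 0.
Proof. by rewrite /skewM /skewval coefZ coefXn; case: eqP; rewrite ?mulr1 ?mulr0. Qed.

Lemma skewMM c d e i : M c d * M e i = M (c * sig d e) (d + i).
Proof.
apply/polyP => j; rewrite coef_skewM_mul !coef_skewM.
case: ltnP => [lt_jd|le_dj]; first by case: eqP => // ?; lia.
rewrite -(eqn_add2l d) subnKC //; case: eqP => // _.
by rewrite iter_sig0 mulr0.
Qed.

Lemma skewMD c e d : M (c + e) d = M c d + M e d.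
Proof. by rewrite /skewM scalerDl. Qed.

Lemma skewM0 d : M 0 d = 0.
Proof. by rewrite /skewM scale0r. Qed.

Lemma skewCE c : skewC sigma c = M c 0.
Proof. by rewrite /skewM expr0 alg_polyC. Qed.

Lemma coef_skew_sum I (s : seq I) (P : pred I) (F : I -> skewpoly sigma) i :
  (skewval (\sum_(j <- s | P j) F j))`_i =
  \sum_(j <- s | P j) (skewval (F j))`_i.
Proof. exact: coef_sum. Qed.

Lemma skew_sumM N p : (size (skewval p) <= N)%N ->
  p = \sum_(i < N) M (skewval p)`_i i.
Proof.
move=> le_pN; rewrite -[RHS](poly_def N (fun i => (skewval p)`_i)).
apply/polyP => i; rewrite coef_poly; case: ltnP => // le_Ni.
by rewrite nth_default // (leq_trans le_pN).
Qed.

(** Moving the factor [c] to the left past t^(d j) twists it by sigma^(d j). *)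
Lemma skewM_exp c d i :
  M c d ^+ i = M (\prod_(j < i) iter (d * j) sigma c) (d * i).
Proof.
elim: i => [|i IHi]; first by rewrite big_ord0 muln0 expr0 -skewCE.
by rewrite exprSr IHi skewMM big_ord_recr /= mulnSr.
Qed.

Lemma size_skewM c d : (size (skewval (M c d)) <= d.+1)%N.
Proof. by apply/leq_sizeP => i lt_di; rewrite coef_skewM gtn_eqF. Qed.

End SkewMonomials.

(** * Remainders modulo a monic, then central, skew polynomial *)

Section Reduction.
Variables (S : comNzRingType) (sigma : {rmorphism S -> S}).
Variable f : skewpoly sigma.
Hypothesis f_monic : skewval f \is monic.
Implicit Types (p q r : skewpoly sigma) (x y : petit f).

Lemma petit_val_inj : injective (@petit_val S sigma f).
Proof. exact: val_inj. Qed.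

Lemma petit_valD x y : petit_val (x + y) = petit_val x + petit_val y.
Proof. by []. Qed.

Lemma size_petit_val x : (size (skewval (petit_val x)) < size (skewval f))%N.
Proof.
rewrite (leq_ltn_trans (size_npoly x)) // prednK //.
by rewrite size_poly_gt0 monic_neq0.
Qed.

Lemma petit_red_small p : (size (skewval p) < size (skewval f))%N ->
  petit_val (petit_red f p) = p.
Proof.
move=> lt_pf; rewrite petit_redK //; apply: (skew_mod_unique (q := 0)) => //.
by rewrite mul0r add0r.
Qed.

Lemma petit_valK x : petit_red f (petit_val x) = x.
Proof.
by apply: petit_val_inj; apply: petit_red_small; apply: size_petit_val.
Qed.

Lemma petit_red_decomp p : exists q, p = q * f + petit_val (petit_red f p).
Proof. by rewrite petit_redK //; have [] := skew_modP p f_monic. Qed.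

(** Uniqueness of the remainder, with the two quotients added. Later identities between remainders
    are proved by exhibiting a left multiple of [f]. *)
Lemma petit_red_congr q p r : p = q * f + r -> petit_red f p = petit_red f r.
Proof.
move=> Dp; apply: petit_val_inj; rewrite petit_redK //.
have [q' Dr] := petit_red_decomp r.
apply: (skew_mod_unique (q := q + q')) => //; first exact: size_petit_val.
by rewrite mulrDl -addrA -Dr.
Qed.

Lemma petit_redD p q : petit_red f (p + q) = petit_red f p + petit_red f q.
Proof.
have [p' Dp] := petit_red_decomp p; have [q' Dq] := petit_red_decomp q.
rewrite (@petit_red_congr (p' + q') _ (petit_val (petit_red f p + petit_red f q))).
  exact: petit_valK.
by rewrite {1}Dp {1}Dq mulrDl addrACA petit_valD.
Qed.

Lemma petit_red0 : petit_red f 0 = 0.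
Proof. by apply: (addrI (petit_red f 0)); rewrite -petit_redD !addr0. Qed.

Lemma petit_red_sum I (s : seq I) (P : pred I) (F : I -> skewpoly sigma) :
  petit_red f (\sum_(i <- s | P i) F i) = \sum_(i <- s | P i) petit_red f (F i).
Proof. exact: (big_morph _ petit_redD petit_red0). Qed.

Hypothesis f_central : forall p, f * p = p * f.

(** Write p = p' f + p0 and q = q' f + q0. In p q, the term p' f q is a left multiple of [f] only
    because [f] commutes with [q]; the term p0 q' f is one already, and p0 q0 remains. *)
Lemma petit_redM p q :
  petit_mul (petit_red f p) (petit_red f q) = petit_red f (p * q).
Proof.
have [p' Dp] := petit_red_decomp p; have [q' Dq] := petit_red_decomp q.
symmetry; apply: (@petit_red_congr (p' * q + petit_val (petit_red f p) * q')).
rewrite {1}Dp mulrDl -mulrA f_central mulrA {2}Dq mulrDr mulrDl !addrA.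
by rewrite mulrA.
Qed.

Lemma petit_red_exp p i : petit_exp (petit_red f p) i = petit_red f (p ^+ i).
Proof.
elim: i => [|i IHi]; first by rewrite expr0.
by rewrite exprS -petit_redM -IHi.
Qed.

End Reduction.

(** * The Petit ring of t^n - a and the map G on it *)

Section Binomial.
Variables (S : comNzRingType) (sigma : {rmorphism S -> S}) (n : nat).
Local Notation sig i := (iter i sigma).
Local Notation M := (skewM sigma).
Local Notation F := (skew_binomial sigma n).
Hypothesis n_gt0 : (0 < n)%N.
Implicit Types (p q r : skewpoly sigma) (a b c e : S) (i j d : nat).

Lemma size_skew_binomial a : size (skewval (F a)) = n.+1.
Proof. by rewrite skew_binomialE size_XnsubC. Qed.

Lemma skew_binomial_monic a : skewval (F a) \is monic.
Proof. by rewrite skew_binomialE monicXnsubC. Qed.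

Lemma size_petit_binomial a (x : petit (F a)) :
  (size (skewval (petit_val x)) <= n)%N.
Proof.
by have := size_petit_val (skew_binomial_monic a) x; rewrite size_skew_binomial.
Qed.

Lemma petit_val_redM a c d : (d < n)%N ->
  petit_val (petit_red (F a) (M c d)) = M c d.
Proof.
move=> lt_dn; apply: (petit_red_small (skew_binomial_monic a)).
by rewrite size_skew_binomial (leq_ltn_trans (size_skewM _ _ _)).
Qed.

Lemma petit_redM_inj a c e d : (d < n)%N ->
  petit_red (F a) (M c d) = petit_red (F a) (M e d) -> c = e.
Proof.
move=> lt_dn /(congr1 (fun x => (skewval (petit_val x))`_d)).
by rewrite !petit_val_redM // !coef_skewM eqxx.
Qed.

Lemma skewM_binomial a c d :
  M c (d + n) = M c d * F a + M (c * sig d a) d.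
Proof.
rewrite /skew_binomial skewTn skewCE mulrBr !skewMM addn0 iter_sig1 mulr1.
by rewrite subrK.
Qed.

(** Each division step trades t^n for [b]. The step leaves the factor sigma^i(b) in the coefficient,
    which is [b] itself, so the powers of [b] accumulate untwisted. *)
Lemma petit_redM_mod b c d : sigma b = b ->
  petit_red (F b) (M c d) = petit_red (F b) (M (c * b ^+ (d %/ n)) (d %% n)).
Proof.
move=> sb; have sib i : sig i b = b by elim: i => //= i ->.
rewrite {1}(divn_eq d n) addnC.
elim: (d %/ n)%N c => [|i IHi] c; first by rewrite mul0n addn0 expr0 mulr1.
rewrite mulSn addnCA addnC.
rewrite (petit_red_congr (skew_binomial_monic b) (skewM_binomial b _ _)).
by rewrite IHi sib exprS mulrA.
Qed.

Hypothesis sigma_n : forall c, sig n c = c.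

(** On monomials: t^n commutes with coefficients because sigma^n = 1, and [a] commutes with t
    because [sigma] fixes it. *)
Lemma skew_binomial_central a p : sigma a = a -> F a * p = p * F a.
Proof.
move=> sa; have sia i : sig i a = a by elim: i => //= i ->.
rewrite (skew_sumM (leqnn (size (skewval p)))) mulr_sumr mulr_suml.
apply: eq_bigr => i _; rewrite /skew_binomial skewTn skewCE mulrBl mulrBr !skewMM.
by rewrite iter_sig1 sigma_n sia mulr1 mul1r addn0 add0n addnC /= mulrC.
Qed.

(** Centrality of t^n - b lets all products and powers be computed in S[t; sigma], with a single
    reduction at the end. *)
Lemma petit_GE a b (tau : S -> S) alpha k (x : petit (F a)) : sigma b = b ->
  petit_G (F b) tau alpha k x =
  petit_red (F b)
    (\sum_(i < n) M (tau (skewval (petit_val x))`_i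
                     * \prod_(j < i) sig (k * j) alpha) (k * i)).
Proof.
move=> sb; have Fc p := skew_binomial_central p sb.
have Fm := skew_binomial_monic b.
rewrite petit_red_sum // /petit_G size_skew_binomial /=; apply: eq_bigr => i _.
rewrite /petitC /petitT !(petit_red_exp, petit_redM) //; congr petit_red.
by rewrite !skewCE skewTn skewMM mulr1 add0n skewM_exp skewMM.
Qed.

Lemma petit_G_red a b (tau : {rmorphism S -> S}) alpha k c d :
    sigma b = b -> (d < n)%N ->
  petit_G (F b) tau alpha k (petit_red (F a) (M c d)) =
  petit_red (F b) (M (tau c * \prod_(j < d) sig (k * j) alpha) (k * d)).
Proof.
move=> sb lt_dn; rewrite petit_GE // petit_val_redM //; congr petit_red.
rewrite (bigD1 (Ordinal lt_dn)) //= coef_skewM eqxx [X in _ + X]big1 ?addr0 // => i.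
by rewrite -val_eqE /= coef_skewM => /negPf->; rewrite rmorph0 mul0r skewM0.
Qed.

End Binomial.

(** * Necessary conditions for an isometry *)

Section IsometryNecessary.
Variables (S : comNzRingType) (sigma tau : {rmorphism S -> S}) (n k : nat).
Variables (a b alpha : S).
Local Notation sig i := (iter i sigma).
Local Notation M := (skewM sigma).
Hypotheses (n_gt1 : (1 < n)%N) (k_gt0 : (0 < k)%N) (lt_kn : (k < n)%N).
Hypothesis sigma_n : forall c, sig n c = c.
Hypothesis sa : sigma a = a.
Hypothesis sb : sigma b = b.
Hypothesis tau_bij : bijective tau.
Hypothesis tau_sigma : forall c, tau (sigma c) = sigma (tau c).
Hypothesis alpha_unit : unit_in predT alpha.
Hypothesis G_iso : isometric_via sigma n a b tau alpha k.

Let n_gt0 : (0 < n)%N. Proof. exact: ltnW. Qed.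
Let Gr := petit_G_red (b := b) n_gt0 sigma_n a tau alpha k.

(* Apply G to t c = sigma(c) t. *)
Lemma isometric_sigma_exp c : sig k c = sigma c.
Proof.
have [_ _ GM _] := G_iso; have [tau' _ tauK] := tau_bij.
have [_ [alpha' _ alphaV]] := alpha_unit.
(* Testing at tau^-1(c) makes [c] arbitrary after G. Since k < n, both images are multiples of t^k
   that need no reduction, so coefficients can be compared and the unit [alpha] cancelled. *)
have := GM (petit_red _ (M 1 1)) (petit_red _ (M (tau' c) 0)).
rewrite {1}/petit_mul !petit_val_redM // skewMM mul1r addn0 !Gr //.
rewrite petit_redM; first last.
- by move=> p; apply: skew_binomial_central.
- exact: skew_binomial_monic.
rewrite skewMM !muln0 !muln1 addn0 => /(petit_redM_inj n_gt0 lt_kn).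
rewrite big_ord1 big_ord0 muln0 rmorph1 mul1r mulr1 /= tau_sigma tauK.
move=> /(congr1 (fun s => s * alpha')).
by rewrite -mulrA alphaV mulr1 => ->; rewrite mulrAC alphaV mul1r.
Qed.

(* Apply G to t^(n-1) t = a. *)
Lemma isometric_tau_norm : tau a = skew_norm sigma n alpha * b ^+ k.
Proof.
have [_ _ GM _] := G_iso.
have := GM (petit_red _ (M 1 n.-1)) (petit_red _ (M 1 1)).
have n1: (n.-1 < n)%N by rewrite prednK.
rewrite {1}/petit_mul !petit_val_redM // skewMM mul1r iter_sig1 addn1 prednK //.
rewrite (petit_redM_mod n_gt0 _ n sa) modnn divnn n_gt0 expr1 mul1r !Gr // petit_redM; first last.
- by move=> p; apply: skew_binomial_central.
- exact: skew_binomial_monic.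
rewrite skewMM -mulnDr addn1 prednK // big_ord0 muln0 mulr1 rmorph1 !mul1r.
rewrite (petit_redM_mod n_gt0 _ (k * n) sb) modnMl mulnK // big_ord1 muln0.
move=> /(petit_redM_inj n_gt0 n_gt0) ->; congr (_ * _).
(* The last factor of the norm comes from G(t), the others from G(t^(n-1)); sigma^k = sigma turns
   the twists by k j into twists by j. *)
rewrite /skew_norm; case: (n) n_gt0 => // n' _ /=; rewrite big_ord_recr /=.
have sk j c : sig (k * j) c = sig j c.
  by rewrite mulnC iterM; apply: eq_iter => d; apply: isometric_sigma_exp.
by rewrite sk; congr (_ * _); apply: eq_bigr => j _; rewrite sk.
Qed.

(* If d = gcd(k, n) > 1 then G sends both t^(n/d) and a constant to the same
   constant. *)
Lemma isometric_coprime : gcdn k n = 1%N.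
Proof.
have [[G' GK _] _ _ _] := G_iso; have [tau' _ tauK] := tau_bij.
set d := gcdn k n; apply/eqP; apply: contraT => d_neq1.
have d_gt0 : (0 < d)%N by rewrite gcdn_gt0 k_gt0.
have d_gt1 : (1 < d)%N by lia.
have lt_ndn : (n %/ d < n)%N by rewrite ltn_Pdiv.
have nd_gt0 : (0 < n %/ d)%N by rewrite divn_gt0 // dvdn_leq // dvdn_gcdr.
(* The exponent of G(t^(n/d)) is a multiple of n, so t^n = b reduces it to the constant [v], which
   is also the image of tau^-1(v). *)
have Dk : (k * (n %/ d) = k %/ d * n)%N.
  by rewrite -{1}(divnK (dvdn_gcdl k n)) -mulnA (mulnC d) divnK ?dvdn_gcdr.
have := Gr 1 sb lt_ndn; set u := (tau 1 * _).
rewrite Dk (petit_redM_mod n_gt0 _ _ sb) modnMl; set v := (u * _) => Gu.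
have Gv : petit_G (skew_binomial sigma n b) tau alpha k
            (petit_red (skew_binomial sigma n a) (M (tau' v) 0)) =
          petit_red (skew_binomial sigma n b) (M v 0).
  by rewrite Gr // big_ord0 mulr1 tauK muln0.
(* At t^(n/d) the two preimages have coefficients 1 and 0, because 0 < n/d < n. *)
have /(congr1 (fun x => (skewval (petit_val x))`_(n %/ d))) :=
  can_inj GK (etrans Gu (esym Gv)).
rewrite !petit_val_redM // !coef_skewM eqxx gtn_eqF // => /eqP.
by rewrite oner_eq0.
Qed.

End IsometryNecessary.

(** * Sufficient conditions: lifting G and inverting it *)

Section IsometrySufficient.
Variables (S : comNzRingType) (sigma tau : {rmorphism S -> S}) (n k : nat).
Variables (a b alpha : S).
Local Notation sig i := (iter i sigma).
Local Notation M := (skewM sigma).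
Local Notation Nm := (skew_norm sigma).
Implicit Types (p q : skewpoly sigma).
Hypothesis n_gt0 : (0 < n)%N.
Hypothesis sigma_n : forall c, sig n c = c.
Hypothesis sb : sigma b = b.
Hypothesis tau_sigma : forall c, tau (sigma c) = sigma (tau c).
Hypothesis sigma_k : forall c, sig k c = sigma c.
Hypothesis tau_a : tau a = Nm n alpha * b ^+ k.

Lemma iter_sig_mull j c : sig (k * j) c = sig j c.
Proof. by rewrite mulnC iterM; apply: eq_iter => d; apply: sigma_k. Qed.

(** The cocycle rule of partial norms, which is the exponent law for the powers of alpha t. *)
Lemma skew_normD i j : Nm (i + j) alpha = Nm i alpha * sig i (Nm j alpha).
Proof.
rewrite /skew_norm big_split_ord /=; congr (_ * _).
rewrite (big_morph _ (iter_sigM sigma i) (iter_sig1 sigma i)).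
by apply: eq_bigr => l _; rewrite iterD.
Qed.

(* The lift of G to the endomorphism of S[t; sigma] extending tau and sending t
   to alpha t^k. *)
Definition skew_hom p : skewpoly sigma :=
  \sum_(i < size (skewval p)) M (tau (skewval p)`_i * Nm i alpha) (k * i).

(** Padding by zero coefficients frees the summation range from the size of [p], so that sums for
    different polynomials can be added. *)
Lemma skew_homE N p : (size (skewval p) <= N)%N ->
  skew_hom p = \sum_(i < N) M (tau (skewval p)`_i * Nm i alpha) (k * i).
Proof.
move=> le_pN; rewrite /skew_hom.
rewrite (big_ord_widen _ (fun i : nat =>
  M (tau (skewval p)`_i * Nm i alpha) (k * i)) le_pN) big_mkcond.
apply: eq_bigr => i _; case: ltnP => // le_pi.
by rewrite nth_default // rmorph0 mul0r skewM0.
Qed.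

Lemma skew_homD p q : skew_hom (p + q) = skew_hom p + skew_hom q.
Proof.
set N := maxn (size (skewval p)) (size (skewval q)).
rewrite !(@skew_homE N) ?leq_maxl ?leq_maxr ?size_polyD // -big_split /=.
by apply: eq_bigr => i _; rewrite coefD rmorphD mulrDl skewMD.
Qed.

Lemma skew_hom0 : skew_hom 0 = 0.
Proof. by apply: (addrI (skew_hom 0)); rewrite -skew_homD !addr0. Qed.

Definition skew_hom_sum := big_morph _ skew_homD skew_hom0.

Lemma skew_hom_monomial c d : skew_hom (M c d) = M (tau c * Nm d alpha) (k * d).
Proof.
rewrite (skew_homE (size_skewM _ c d)) (bigD1 ord_max) //= coef_skewM eqxx.
rewrite [X in _ + X]big1 ?addr0 // => i; rewrite -val_eqE /= coef_skewM => /negPf->.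
by rewrite rmorph0 mul0r skewM0.
Qed.

(** By additivity monomials suffice. There the twist sigma^(k i) is sigma^i, [tau] commutes with it,
    and the norms combine by the cocycle rule. *)
Lemma skew_homM p q : skew_hom (p * q) = skew_hom p * skew_hom q.
Proof.
have tau_sig i c : tau (sig i c) = sig i (tau c).
  by elim: i => //= i <-; rewrite tau_sigma.
rewrite (skew_sumM (leqnn (size (skewval p)))).
rewrite (skew_sumM (leqnn (size (skewval q)))) mulr_suml !skew_hom_sum mulr_suml.
apply: eq_bigr => i _; rewrite !mulr_sumr skew_hom_sum.
apply: eq_bigr => j _; rewrite skewMM !skew_hom_monomial skewMM -mulnDr.
by rewrite iter_sig_mull skew_normD rmorphM tau_sig iter_sigM; congr skewM; ring.
Qed.

Lemma petit_G_skew_hom (x : petit (skew_binomial sigma n a)) :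
  petit_G (skew_binomial sigma n b) tau alpha k x =
  petit_red _ (skew_hom (petit_val x)).
Proof.
rewrite petit_GE // (skew_homE (size_petit_binomial n_gt0 x)); congr petit_red.
apply: eq_bigr => i _; congr (M (_ * _) _).
by apply: eq_bigr => j _; rewrite iter_sig_mull.
Qed.

(** The lift sends t^n - a to a left multiple of t^n - b, so it passes to remainders. This transfers
    multiplicativity from the lift to G. *)
Lemma petit_G_petit_red p :
  petit_G (skew_binomial sigma n b) tau alpha k
    (petit_red (skew_binomial sigma n a) p) = petit_red _ (skew_hom p).
Proof.
rewrite petit_G_skew_hom.
have [q Dp] := petit_red_decomp (skew_binomial_monic sigma n_gt0 a) p.
have Fm := skew_binomial_monic sigma n_gt0 b.
(* The image is N(alpha) t^(k n) - tau(a), and t^(k n) reduces to b^k; [tau_a] makes the difference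
   vanish. *)
have hom_a : petit_red (skew_binomial sigma n b)
               (skew_hom (skew_binomial sigma n a)) = 0.
  have -> : skew_binomial sigma n a = M 1 n + M (- a) 0.
    by rewrite /skew_binomial skewTn skewCE /skewM scaleNr.
  rewrite skew_homD !skew_hom_monomial rmorph1 rmorphN tau_a muln0 mul1r.
  rewrite petit_redD // petit_redM_mod // modnMl mulnK // -petit_redD // -skewMD.
  by rewrite /skew_norm big_ord0 mulr1 subrr skewM0 petit_red0.
have [r] := petit_red_decomp Fm (skew_hom (skew_binomial sigma n a)).
rewrite hom_a addr0 => Dr.
apply/esym/(petit_red_congr Fm (q := skew_hom q * r)).
by rewrite {1}Dp skew_homD skew_homM Dr mulrA.
Qed.

Hypothesis tau_bij : bijective tau.
Hypothesis alpha_unit : unit_in predT alpha.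
Hypothesis b_unit : exists b', b * b' = 1.
Hypothesis coprime_kn : coprime k n.

(** The scalar in G(t^i): (alpha t^k)^i is N_i(alpha) t^(k i), and each t^n split off from t^(k i)
    contributes a factor [b]. *)
Let w i := Nm i alpha * b ^+ (k * i %/ n).

Lemma petit_G_weight_unit i : exists v, w i * v = 1.
Proof.
have [_ [alpha' _ alphaV]] := alpha_unit; have [b' bV] := b_unit.
exists (Nm i alpha' * b' ^+ (k * i %/ n)).
rewrite mulrACA -exprMn bV expr1n mulr1 -big_split /=.
by rewrite big1 // => j _; rewrite -iter_sigM alphaV iter_sig1.
Qed.

(** For i <= j, n divides k (j - i), hence j - i by coprimality, and j - i < n. *)
Lemma modn_mull_inj i j : (i < n)%N -> (j < n)%N ->
  k * i = k * j %[mod n] -> i = j.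
Proof.
move=> lt_in lt_jn.
wlog le_ij : i j lt_in lt_jn / (i <= j)%N => [IH|].
  by case/orP: (leq_total i j) => le_ij Eij; [|symmetry]; apply: IH.
move/esym/eqP; rewrite eqn_mod_dvd ?leq_mul2l ?le_ij ?orbT // -mulnBr.
rewrite Gauss_dvdr 1?coprime_sym // => /dvdnP[[|l]]; lia.
Qed.

(** The positions k j mod n are distinct for distinct j < n, so only the i-th term of the sum
    contributes here. *)
Lemma coef_petit_G (x : petit (skew_binomial sigma n a)) i : (i < n)%N ->
  (skewval (petit_val (petit_G (skew_binomial sigma n b) tau alpha k x)))
    `_(k * i %% n) = tau (skewval (petit_val x))`_i * w i.
Proof.
move=> lt_in; rewrite petit_G_skew_hom (skew_homE (size_petit_binomial n_gt0 x)).
rewrite (petit_red_sum (skew_binomial_monic sigma n_gt0 b)).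
rewrite (big_morph (fun y => (skewval (petit_val y))`_(k * i %% n))
  (id1 := 0) (op1 := +%R)); last 2 first.
- by move=> y z; rewrite petit_valD coefD.
- exact: coef0.
rewrite (bigD1 (Ordinal lt_in)) //= big1 ?addr0 => [|j ne_ji].
  by rewrite petit_redM_mod // petit_val_redM ?ltn_pmod // coef_skewM eqxx mulrA.
rewrite petit_redM_mod // petit_val_redM ?ltn_pmod // coef_skewM.
case: eqP => // /modn_mull_inj Eij; case/eqP: ne_ji.
by apply: val_inj; rewrite /= Eij.
Qed.

Lemma petit_G_bij : bijective (@petit_G S sigma (skew_binomial sigma n a)
  (skew_binomial sigma n b) tau alpha k).
Proof.
have [tau' tauK tau'K] := tau_bij.
(* Finite choice assembles inverses of the weights into one function. *)
have [v wv] : exists v : 'I_n -> S, forall i : 'I_n, w i * v i = 1.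
  by apply: (fin_all_exists (P := fun (i : 'I_n) s => w i * s = 1)) => i;
    apply: petit_G_weight_unit.
pose pi (i : 'I_n) := Ordinal (ltn_pmod (k * i) n_gt0).
have pi_inj : injective pi.
  by move=> i j /(congr1 val) /modn_mull_inj Eij; apply/val_inj/Eij.
have [rho _ piK] := injF_bij pi_inj.
(* The inverse of G: read the coefficient at k i mod n, divide by the weight, apply tau^-1. *)
pose h (y : petit (skew_binomial sigma n b)) :=
  petit_red (skew_binomial sigma n a)
    (\sum_(i < n) M (tau' ((skewval (petit_val y))`_(pi i) * v i)) i).
have coef_h y (i : 'I_n) : (skewval (petit_val (h y)))`_i =
    tau' ((skewval (petit_val y))`_(pi i) * v i).
  rewrite petit_red_small; first 1 last.
  - exact: skew_binomial_monic.
  - rewrite size_skew_binomial // ltnS; apply/leq_sizeP => j le_nj.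
    rewrite coef_skew_sum big1 // => l _; rewrite [LHS]coef_skewM.
    by rewrite gtn_eqF // (leq_trans (ltn_ord l)).
  rewrite coef_skew_sum (bigD1 i) //= [X in X + _]coef_skewM eqxx.
  rewrite big1 ?addr0 // => j; rewrite -val_eqE /= => ne_ji.
  by rewrite [LHS]coef_skewM eq_sym (negPf ne_ji).
have petit_eq c (x y : petit (skew_binomial sigma n c)) :
    (forall i : 'I_n, (skewval (petit_val x))`_i = (skewval (petit_val y))`_i) ->
  x = y.
  move=> Exy; apply/petit_val_inj/polyP => i.
  have [lt_in|le_ni] := ltnP i n; first exact: (Exy (Ordinal lt_in)).
  by rewrite !nth_default // (leq_trans (size_petit_binomial n_gt0 _)).
exists h => x; apply: petit_eq => i.
  by rewrite coef_h coef_petit_G // -mulrA wv mulr1 tauK.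
(* Every position is some [pi l], which is where [coef_petit_G] applies. *)
rewrite -(piK i); set l := rho i.
by rewrite [in LHS]coef_petit_G // coef_h tau'K -mulrA (mulrC (v _)) wv mulr1.
Qed.

Lemma petit_G_isometric : isometric_via sigma n a b tau alpha k.
Proof.
split; first exact: petit_G_bij.
- by move=> x y; rewrite !petit_G_skew_hom petit_valD skew_homD petit_redD //
    skew_binomial_monic.
- move=> x y; rewrite {1}/petit_mul petit_G_petit_red skew_homM -petit_redM.
  + by rewrite !petit_G_skew_hom.
  + exact: skew_binomial_monic.
  + by move=> p; apply: skew_binomial_central.
- rewrite /petitC petit_G_petit_red !skewCE skew_hom_monomial rmorph1 mul1r muln0.
  by rewrite /skew_norm big_ord0.
Qed.

End IsometrySufficient.

(** * The isometry criterion and the equivalences *)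

Lemma bijective_iter_period (T : Type) (g : T -> T) (m k : nat) :
    bijective g -> has_order g m -> (0 < k)%N ->
  (forall x, iter k g x = g x) -> k = 1 %[mod m].
Proof.
move=> g_bij [m_gt0 gm g_min] k_gt0 gk; apply/eqP; rewrite eqn_mod_dvd //.
have g_k1 : iter (k - 1) g =1 id.
  move=> x; apply: (bij_inj g_bij).
  by rewrite -iterS subn1 prednK.
(* Otherwise (k - 1) mod m is a positive period smaller than the order. *)
apply: contraT => ndvd; case: (g_min ((k - 1) %% m)%N).
  by rewrite lt0n ltn_mod m_gt0 andbT.
move=> x; rewrite -{2}[x]g_k1 {2}(divn_eq (k - 1) m) addnC iterD; congr iter.
by elim: (_ %/ m)%N => //= j IHj; rewrite mulSn iterD gm.
Qed.

Lemma isometric_viaP (S : comNzRingType) (sigma tau : {rmorphism S -> S})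
    (m n k : nat) (a b alpha : S) :
    bijective sigma -> has_order sigma m -> (1 < n)%N -> (m %| n)%N ->
    sigma a = a -> unit_in (fixed_ring sigma) b -> bijective tau ->
    (forall x, tau (sigma x) = sigma (tau x)) -> unit_in predT alpha ->
    (1 <= k < n)%N ->
  isometric_via sigma n a b tau alpha k <->
  [/\ tau a = skew_norm sigma n alpha * b ^+ k,
      k = 1 %[mod m] & gcdn k n = 1%N].
Proof.
move=> sigma_bij sigma_order n_gt1 dvd_mn sa [/eqP sb [b' _ bV]] tau_bij.
move=> tau_sigma alpha_unit /andP[k_gt0 lt_kn].
have [m_gt0 sigma_m _] := sigma_order.
have sigma_mul j c : iter (j * m) sigma c = c.
  by elim: j => //= j IHj; rewrite mulSn iterD IHj sigma_m.
have sigma_n c : iter n sigma c = c by rewrite -(divnK dvd_mn).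
split=> [iso | [tau_a k1 co_kn]].
  split; first exact: isometric_tau_norm iso.
    apply: (bijective_iter_period sigma_bij sigma_order k_gt0) => c.
    exact: isometric_sigma_exp iso c.
  exact: isometric_coprime iso.
apply: petit_G_isometric => //; first exact: ltnW.
(* As m divides k - 1, sigma^(k-1) = 1 and so sigma^k = sigma. *)
- have dvd_k : (m %| k - 1)%N by rewrite -eqn_mod_dvd //; apply/eqP.
  by move=> c; rewrite -(prednK k_gt0) -subn1 iterS -(divnK dvd_k) sigma_mul.
- by exists b'.
- exact/eqP.
Qed.

Theorem theorem5p12 (S : comNzRingType) (sigma tau : {rmorphism S -> S})
    (m n k : nat) (a b alpha : S)
    (sigma_aut : bijective sigma) (sigma_order : has_order sigma m)
    (n_ge2 : (2 <= n)%N) (dvd_mn : (m %| n)%N)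
    (a_unit : unit_in (fixed_ring sigma) a)
    (b_unit : unit_in (fixed_ring sigma) b)
    (tau_aut : bijective tau)
    (tau_sigma : forall x, tau (sigma x) = sigma (tau x))
    (alpha_unit : unit_in predT alpha)
    (k_range : (1 <= k < n)%N) :
  [<-> isometric_via sigma n a b tau alpha k;
       [/\ equivalent_via sigma n a (b ^+ k) tau alpha,
           k = 1 %[mod m] & gcdn k n = 1%N];
       [/\ tau a = skew_norm sigma n alpha * b ^+ k,
           k = 1 %[mod m] & gcdn k n = 1%N]].
Proof.
have /eqP sa := a_unit.1.
have bk_unit : unit_in (fixed_ring sigma) (b ^+ k).
  have [/eqP sb [b' /eqP sb' bV]] := b_unit.
  split; first by apply/eqP; rewrite rmorphXn sb.
  exists (b' ^+ k); first by apply/eqP; rewrite rmorphXn sb'.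
  by rewrite -exprMn bV expr1n.
have iso_k := isometric_viaP sigma_aut sigma_order n_ge2 dvd_mn sa b_unit
  tau_aut tau_sigma alpha_unit k_range.
have iso_1 := isometric_viaP (k := 1) sigma_aut sigma_order n_ge2 dvd_mn sa
  bk_unit tau_aut tau_sigma alpha_unit n_ge2.
tfae.
- move=> /iso_k[tau_a k1 co_kn]; split=> //.
  (* At exponent 1 the congruence and the coprimality are trivial, and only the norm equation
     remains. *)
  by apply/iso_1; rewrite expr1 gcd1n.
- by case=> /iso_1[tau_a _ _] k1 co_kn; split=> //; rewrite tau_a expr1.
- by move=> /iso_k.
Qed.
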